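(* Let $n\ge 1$, $d\ge1$, $r\geq 1$, $D\subseteq D(d)$ and $\mathbf m=(m_1,\ldots,m_r)\in\mathbb N^r$. Suppose the triple $(n,D,\mathbf m)$ admits an exceptional partition with respect to some square sub-matrix $(U',D')$ of $M_D(\mathbf m)$ with $U'\subseteq U_{k+1}\cup\cdots\cup U_r$ for some $0\le k\leq r$. Then $$\dim V^n_D(m_1,\ldots,m_r)\leq\dim V^n_{D\smallsetminus D'}(m_1,\ldots,m_k).$$ In particular, if $k=0$, then $\dim V^n_D(\mathbf m)\leq\#(D\smallsetminus D')$.
   Context: $\mathbb K$ is a field of characteristic $0$, and $\mathbb N=\{0,1,2,\ldots\}$. For $\mathbf a=(a_0,\ldots,a_n)\in\mathbb N^{n+1}$ put $|\mathbf a|=a_0+\cdots+a_n$ and $\mathbf X^{\mathbf a}=X_0^{a_0}\cdots X_n^{a_n}$; $D(d)=\{\mathbf a\in\mathbb N^{n+1}: |\mathbf a|=d\}$ (with $D(-1)=\varnothing$). For $D\subseteq D(d)$, $V^n_D$ is the $\mathbb K$-span of the monomials $\mathbf X^{\mathbf a}$, $\mathbf a\in D$, in $\mathbb K[X_0,\ldots,X_n]$. For points $p_1,\ldots,p_r\in\mathbb P^n=\mathbb{KP}^n$, $V^n_D(m_1p_1,\ldots,m_rp_r)$ is the subspace of those $f\in V^n_D$ vanishing with multiplicity at least $m_i$ at $p_i$ for every $i$. $V^n_D(m_1,\ldots,m_r)=V^n_D(\mathbf m)$ denotes this space for general points; so $\dim V^n_D(\mathbf m)$ is the value of $\dim V^n_D(m_1p_1,\ldots,m_rp_r)$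 that is constant on a nonempty Zariski-open set of $(p_1,\ldots,p_r)\in(\mathbb P^n)^r$. With no points, the space is $V^n_D$. Matrix: let $U_i=\{(i,\mathbf b):\mathbf b\in D(m_i-1)\}$ and $U=U_1\cup\cdots\cup U_r$. Let $\mathbf P_i=(P_{i,0},\ldots,P_{i,n})$ be independent indeterminates. $M=M_D(\mathbf m)$ is the matrix with rows indexed by $U$, columns indexed by $D$, and entry in row $(i,\mathbf b)$, column $\mathbf a$ equal to $\frac{\partial^{|\mathbf b|}\mathbf X^{\mathbf a}}{\partial\mathbf X^{\mathbf b}}(\mathbf P_i)$. For $I\subseteq U$ and $J\subseteq D$, $(I,J)$ denotes the sub-matrix with rows $I$ and columns $J$; $\det(\varnothing,\varnothing)=1$. Exceptional partitions: for a square sub-matrix $(U',D')$ of $M$ put $U'_i=U'\cap U_i$, and let $\mathcal P(U',D')$ be the set of partitions $\mathbf E=(E_1,\ldots,E_r)$ of $D'$ (parts may be empty) with $\#E_i=\#U'_i$ for all $i$. Put $\sigma(\mathbf E)=\pm\prod_{i=1}^r\det(U'_i,E_i)$ and $\mathbf a_i(\mathbf E)=\sum_{\mathbf a\in E_i}\mathbf a$. A partition $\mathbf E\in\mathcal P(U',D')$ is exceptional with respect to $(U',D')$ if (1) $\sigma(\mathbf E)\ne0$; and (2) whenever $D''\subseteq D$ has $\#D''=\#D'$ and $\mathbf F\in\mathcal P(U',D'')$ is a partition different from $\mathbf E$ with $\mathbf a_i(\mathbf F)=\mathbf a_i(\mathbf E)$ for all $i$, then $\sigma(\mathbf F)=0$.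 *)

(* Defs.v *)
From HB Require Import structures.
From mathcomp Require Import all_boot all_order all_algebra.
From mathcomp.multinomials Require Import mpoly.
From Stdlib Require ClassicalEpsilon.

Set Implicit Arguments.
Unset Strict Implicit.
Unset Printing Implicit Defensive.

Import GRing.Theory.

Local Open Scope ring_scope.

(* Exponent vectors (a_0, ..., a_n) are elements of 'X_{1..n.+1}; those of total
   degree < b form the finite type 'X_{1..n.+1 < b}. Sets D of exponents of
   degree d are elements of {set 'X_{1..n.+1 < d.+1}} contained in Ddeg n d. *)
Definition Ddeg (n d : nat) : {set 'X_{1..n.+1 < d.+1}} :=
  [set a : 'X_{1..n.+1 < d.+1} | mdeg a == d].

Section LinearSystems.
Context (K : fieldType) (n d : nat).

(* dhomog n.+1 K d is the space of homogeneous forms of degree d. The map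
   indhomog sends polynomials not in that space to 0, which is harmless as
   long as D \subset Ddeg n d. *)
Definition VD (D : {set 'X_{1..n.+1 < d.+1}}) : {vspace dhomog n.+1 K d} :=
  <<[seq indhomog d 'X_[bmnm a] | a <- enum D]>>%VS.

Definition deriv_at (b : 'X_{1..n.+1}) (x : 'I_n.+1 -> K)
    (f : dhomog n.+1 K d) : K^o :=
  (mderivm b f).@[x].

Fact deriv_at_is_linear b x : linear (deriv_at b x).
Proof. by move=> c f g; rewrite /deriv_at /= linearP mevalD mevalZ. Qed.

HB.instance Definition _ b x :=
  GRing.isLinear.Build K (dhomog n.+1 K d) K^o _ (deriv_at b x)
    (deriv_at_is_linear b x).

(* f has multiplicity at least mu at the point with homogeneous coordinates x:
   all the partial derivatives of f of order < mu vanish at x. *)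
Definition Vmult (mu : nat) (x : 'I_n.+1 -> K) : {vspace dhomog n.+1 K d} :=
  (\bigcap_(b : 'X_{1..n.+1 < mu}) lker (linfun (deriv_at b x)))%VS.

Lemma mem_Vmult mu x (f : dhomog n.+1 K d) :
  reflect (forall b : 'X_{1..n.+1}, (mdeg b < mu)%N -> (mderivm b f).@[x] = 0)
          (f \in Vmult mu x).
Proof.
apply: (iffP subv_bigcapP) => [H b ltb | H b _].
  by have := H (BMultinom ltb) isT; rewrite -memvE memv_ker lfunE => /eqP.
by rewrite -memvE memv_ker lfunE; apply/eqP/H/bmdeg.
Qed.

(* A point of (P^n)^r is given by homogeneous coordinates: row i of p
   represents p_i. *)
Definition is_point (r : nat) (p : 'M[K]_(r, n.+1)) : Prop :=
  forall i, row i p != 0.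

(* V_D(m_1 p_1, ..., m_r p_r) *)
Definition VDp (D : {set 'X_{1..n.+1 < d.+1}}) (r : nat) (m : 'I_r -> nat)
    (p : 'M[K]_(r, n.+1)) : {vspace dhomog n.+1 K d} :=
  (VD D :&: \bigcap_(i < r) Vmult (m i) (p i))%VS.

End LinearSystems.

(* The Zariski topology of (P^n)^r. Polynomials in the r blocks of n.+1
   coordinates have their variables indexed by 'I_(r * n.+1), the coordinate
   (i, j) having index mxvec_index i j. *)
Section Zariski.
Context (K : fieldType) (n r : nat).

Definition multihomogeneous (g : {mpoly K[r * n.+1]}) : Prop :=
  exists e : 'I_r -> nat, forall c, c \in msupp g ->
    forall i, (\sum_(j < n.+1) c (mxvec_index i j))%N = e i.

(* Closed sets are the common zero loci of sets S of multihomogeneous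
   polynomials. Only the values of W on actual coordinates of points matter. *)
Definition zariski_open (W : 'M[K]_(r, n.+1) -> Prop) : Prop :=
  exists S : {mpoly K[r * n.+1]} -> Prop,
    (forall g, S g -> multihomogeneous g) /\
    forall p, is_point p -> (W p <-> exists2 g, S g & g.@[mxvec p 0] != 0).

End Zariski.

Section GeneralDimension.
Context (K : fieldType) (n d : nat).

Definition is_general_dim (D : {set 'X_{1..n.+1 < d.+1}}) (r : nat)
    (m : 'I_r -> nat) (v : nat) : Prop :=
  exists W : 'M[K]_(r, n.+1) -> Prop,
    [/\ zariski_open W, exists2 p, is_point p & W p
      & forall p, is_point p -> W p -> \dim (VDp D m p) = v].

(* dim V_D(m_1, ..., m_r): the value v such that is_general_dim D m v, which
   exists and is unique over an infinite field. *)
Definition general_dim (D : {set 'X_{1..n.+1 < d.+1}}) (r : nat)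
    (m : 'I_r -> nat) : nat :=
  ClassicalEpsilon.epsilon (inhabits 0%N) (is_general_dim D m).

End GeneralDimension.

Section InterpolationMatrix.
Context (K : fieldType) (n d r : nat) (m : 'I_r -> nat).

(* A pair (i, b) is Tagged _ b, with tag i; the condition |b| = m_i - 1 is
   written so that it has no solution when m_i = 0. *)
Definition rowidx : Type := {i : 'I_r & 'X_{1..n.+1 < m i}}.
HB.instance Definition _ := Finite.on rowidx.

Definition Urows : {set rowidx} :=
  [set u : rowidx | (mdeg (tagged u)).+1 == m (tag u)].

Definition block (U' : {set rowidx}) (i : 'I_r) : {set rowidx} :=
  [set u in U' | tag u == i].

(* The indeterminates P_{i,0}, ..., P_{i,n}. *)
Definition Pvars (i : 'I_r) : n.+1.-tuple {mpoly K[r * n.+1]} :=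
  [tuple 'X_(mxvec_index i j) | j < n.+1].

Definition Mentry (u : rowidx) (a : 'X_{1..n.+1}) : {mpoly K[r * n.+1]} :=
  mderivm (tagged u) 'X_[K, a] \mPo Pvars (tag u).

Definition Msub (I : {set rowidx}) (J : {set 'X_{1..n.+1 < d.+1}}) :
    'M[{mpoly K[r * n.+1]}]_(#|I|, #|J|) :=
  \matrix_(x < #|I|, y < #|J|) Mentry (enum_val x) (bmnm (enum_val y)).

(* det(I, J), for #|I| = #|J|; conform_mx only transports Msub I J along that
   equality. *)
Definition minor (I : {set rowidx}) (J : {set 'X_{1..n.+1 < d.+1}}) :
    {mpoly K[r * n.+1]} :=
  \det (conform_mx (0 : 'M_#|I|) (Msub I J)).

(* Parts are indexed by 'I_r and may be empty. *)
Definition partitions (U' : {set rowidx}) (D' : {set 'X_{1..n.+1 < d.+1}})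
    (E : {ffun 'I_r -> {set 'X_{1..n.+1 < d.+1}}}) : Prop :=
  [/\ \bigcup_(i < r) E i = D',
      forall i j, i != j -> [disjoint E i & E j]
    & forall i, #|E i| = #|block U' i| ].

(* One of the two sign choices: only the vanishing of sigma matters. *)
Definition sigma (U' : {set rowidx})
    (E : {ffun 'I_r -> {set 'X_{1..n.+1 < d.+1}}}) : {mpoly K[r * n.+1]} :=
  \prod_(i < r) minor (block U' i) (E i).

Definition expsum (E : {ffun 'I_r -> {set 'X_{1..n.+1 < d.+1}}})
    (i : 'I_r) : 'X_{1..n.+1} :=
  (\sum_(a in E i) (a : 'X_{1..n.+1}))%MM.

Definition exceptional (D : {set 'X_{1..n.+1 < d.+1}}) (U' : {set rowidx})
    (D' : {set 'X_{1..n.+1 < d.+1}})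
    (E : {ffun 'I_r -> {set 'X_{1..n.+1 < d.+1}}}) : Prop :=
  [/\ partitions U' D' E,
      sigma U' E != 0
    & forall (D'' : {set 'X_{1..n.+1 < d.+1}})
             (F : {ffun 'I_r -> {set 'X_{1..n.+1 < d.+1}}}),
        D'' \subset D -> #|D''| = #|D'| -> partitions U' D'' F -> F <> E ->
        (forall i, expsum F i = expsum E i) -> sigma U' F = 0].

End InterpolationMatrix.

(* Main.v *)
From HB Require Import structures.
Require Import Defs.
From mathcomp Require Import all_boot all_order all_algebra perm.
From mathcomp.multinomials Require Import mpoly.
From Stdlib Require ClassicalEpsilon.

(** The dimension of V_D(m_1 p_1, ..., m_r p_r) is #D - rank A_D(p), where the
    row of A_D(p) indexed by (i, b), |b| < m_i, holds the values at p_i of the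
    b-th derivatives of the monomials X^a, a in D.  Taking all the derivatives
    of order below m_i, rather than only those of order m_i - 1, makes this an
    identity at every tuple of points ([dim_VDp]).  The rank is lower
    semicontinuous and the minors are multihomogeneous, so the dimension is
    constant on a nonempty open set ([general_dimP]), where it takes its least
    value ([general_dim_le]).

    It is thus enough to find one p with
      rank A_D(p) >= rank A_{D - D'}(p_1, ..., p_k) + #D',
    for given general p_1, ..., p_k.  Let (I0, J0) be a nonzero minor of
    A_{D - D'}(p_1, ..., p_k) of maximal size, and consider the square matrix
    with rows I0 and U' and columns J0 and D': the rows in I0 are constants,
    and those in U' are polynomials in the coordinates of P_{k+1}, ..., P_r.  If
    its determinant is not the zero polynomial, any point q at which it does
    not vanish completes p_1, ..., p_k to a suitable p ([rank_splice]).

    The determinant is nonzero for the following reason.  Up to a factor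
    P_i^b depending only on the row, the entry in row (i, b) and column a is a
    number times P_i^a.  In the expansion over all bijections between rows and
    columns, group the terms according to the block of rows assigned to each
    column: a map phi from columns to blocks contributes the monomial
    prod_i P_i^(sum of the a with phi a = i), with coefficient the determinant
    of the matrix of numbers in which the entries not compatible with phi are
    replaced by 0 ([det_monomial_rows]).  Up to order of rows and columns that
    is a block matrix, and it is invertible exactly when all its blocks are
    ([det_mask_neq0]); for the part of the columns sent to block i, this says
    that det(U'_i, F_i) is nonzero ([minor_class_part_neq0]).  Now look at the
    monomial of the exceptional partition E, extended by sending J0 to I0.
    Another phi with the same monomial and a nonzero determinant would give a
    partition F with the same a_i as E and sigma(F) nonzero, which is excluded;
    the phi of E itself has a nonzero determinant since sigma(E) and the minor
    (I0, J0) are nonzero.  So this monomial has a nonzero coefficient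
    ([det_mixed_mx_neq0]).  Working with kernels of the blocks, instead of
    expanding the determinant as a signed sum of products of minors, avoids
    all the signs of Laplace's formula. *)

Set Implicit Arguments.
Unset Strict Implicit.
Unset Printing Implicit Defensive.
Import GRing.Theory.
Local Open Scope ring_scope.

(** * Nonvanishing points of polynomials *)

Lemma base_expansion_inj (B N : nat) (f g : 'I_N -> nat) :
    (forall i, f i < B)%N -> (forall i, g i < B)%N ->
  (\sum_i f i * B ^ i = \sum_i g i * B ^ i)%N -> f =1 g.
Proof.
elim: N f g => [f g _ _ _ [] //|N IH f g ltf ltg].
have shift (h : 'I_N.+1 -> nat) : (\sum_i h i * B ^ i
    = (\sum_(i < N) h (lift ord0 i) * B ^ i) * B + h ord0)%N.
  rewrite big_ord_recl expn0 muln1 addnC big_distrl /=; congr (_ + _)%N.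
  by apply: eq_bigr => i _; rewrite -mulnA -expnSr.
have B0 : (0 < B)%N by apply: leq_trans (ltf ord0).
rewrite !shift => eqfg.
have eq0 : f ord0 = g ord0.
  by have := congr1 (modn^~ B) eqfg; rewrite !modnMDl !modn_small.
have eqS : (\sum_(i < N) f (lift ord0 i) * B ^ i
           = \sum_(i < N) g (lift ord0 i) * B ^ i)%N.
  by have := congr1 (divn^~ B) eqfg; rewrite !divnMDl ?divn_small // !addn0.
move=> i; case: (unliftP ord0 i) => [j ->|-> //].
exact: (IH _ _ (fun i => ltf _) (fun i => ltg _) eqS).
Qed.

(** The images of 0, 1, 2, ... are more points than ['X * P] has roots. *)
Lemma poly_nonroot (K : fieldType) (charK : [pchar K] =i pred0) (P : {poly K}) :
  P != 0 -> exists2 x, x != 0 & P.[x] != 0.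
Proof.
move=> nzP; pose Q := 'X * P.
have nzQ : Q != 0 by rewrite mulf_neq0 ?polyX_eq0.
pose s := [seq (i%:R : K) | i <- iota 0 (size Q)].
have inj : injective (fun i : nat => i%:R : K).
  move=> i j /eqP; wlog: i j / (i <= j)%N => [W|leij].
    by case/orP: (leq_total i j) => /W // W' /eqP/esym/eqP/W'.
  rewrite eq_sym -subr_eq0 -natrB // ((pcharf0P K).1 charK).
  by rewrite subn_eq0 => leji; apply/eqP; rewrite eqn_leq leij.
have us : uniq s by rewrite map_inj_uniq ?iota_uniq.
have /allPn[x _ nrx] : ~~ all (root Q) s.
  apply/negP => all_s; have := max_poly_roots nzQ all_s us.
  by rewrite size_map size_iota ltnn.
move: nrx; rewrite rootE hornerM hornerX mulf_eq0 negb_or => /andP[nx nPx].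
by exists x.
Qed.

(** Kronecker's substitution X_i := x^(B^i), with B above all the exponents
    of [g], sends distinct monomials of [g] to distinct powers of x, and thus
    reduces the claim to one variable.  Making all the coordinates nonzero
    ensures that they are the coordinates of points of projective spaces. *)
Lemma mpoly_nonroot (K : fieldType) (charK : [pchar K] =i pred0) (N : nat)
    (g : {mpoly K[N]}) :
  g != 0 -> exists2 x : 'I_N -> K, (forall i, x i != 0) & g.@[x] != 0.
Proof.
move=> nzg; pose B := msize g.
pose code (c : 'X_{1..N}) := (\sum_i c i * B ^ i)%N.
pose P : {poly K} := \sum_(c <- msupp g) g@_c *: 'X^(code c).
have ltB c : c \in msupp g -> forall i, (c i < B)%N.
  move=> gc i; apply: leq_ltn_trans (msize_mdeg_lt gc).
  by rewrite mdegE (bigD1 i) //= leq_addr.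
have nzP : P != 0.
  have gl := mlead_supp nzg.
  have: P`_(code (mlead g)) != 0.
    rewrite coef_sum (bigD1_seq (mlead g)) ?msupp_uniq //=.
    rewrite big_seq_cond big1 ?addr0.
      by rewrite coefZ coefXn eqxx mulr1 -mcoeff_msupp.
    move=> c /andP[gc neq]; rewrite coefZ coefXn.
    case: eqP => [eqc|]; last by rewrite mulr0.
    case/eqP: neq; apply/mnmP.
    exact/(base_expansion_inj (ltB _ gc) (ltB _ gl)).
  by apply: contraNneq => ->; rewrite coef0.
have [x nx nPx] := poly_nonroot charK nzP.
exists (fun i => x ^+ (B ^ i)) => [i|]; first by rewrite expf_neq0.
rewrite mevalE; suff <- : P.[x] = \sum_(c <- msupp g)
   g@_c * \prod_(i < N) (x ^+ (B ^ i)) ^+ c i by [].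
rewrite horner_sum; apply: eq_bigr => c _.
rewrite hornerZ hornerXn; congr (_ * _).
rewrite -prodrXr; apply: eq_bigr => i _; by rewrite -exprM mulnC.
Qed.

(** * Rank and square submatrices *)

Lemma leq_rank_unit_mxsub (K : fieldType) (a b N : nat) (A : 'M[K]_(a, b))
    (f : 'I_N -> 'I_a) (g : 'I_N -> 'I_b) :
  mxsub f g A \in unitmx -> (N <= \rank A)%N.
Proof.
move=> /mxrank_unit rkN; rewrite -{}[X in (X <= _)%N]rkN mxsubrc.
apply: leq_trans (mxrankS (rowsub_sub _ _)) _.
by rewrite -mxrank_tr trmx_mxsub -(mxrank_tr A) mxrankS ?rowsub_sub.
Qed.

(** A basis among the rows, then a basis among the columns of what is left. *)
Lemma unit_mxsub_exists (K : fieldType) (a b : nat) (A : 'M[K]_(a, b)) :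
  exists (f : 'I_(\rank A) -> 'I_a) (g : 'I_(\rank A) -> 'I_b),
    injective g /\ mxsub f g A \in unitmx.
Proof.
pose B := rowsub (maxrankfun A) A.
have rkBt : \rank B^T == \rank A
  by rewrite mxrank_tr -/(row_free B) maxrowsub_free.
exists (maxrankfun A), (fullrankfun rkBt); split; first exact: fullrankfun_inj.
by rewrite mxsubcr -unitmx_tr trmx_mxsub fullrowsub_unit.
Qed.

Lemma span_rowsS (K : fieldType) (a b q : nat) (A : 'M[K]_(a, q))
    (B : 'M[K]_(b, q)) : (A <= B)%MS ->
  (<<[seq row i A | i <- enum 'I_a]>> <= <<[seq row i B | i <- enum 'I_b]>>)%VS.
Proof.
case/submxP=> C ->; apply/span_subvP => _ /mapP[i _ ->].
rewrite row_mul mulmx_sum_row memv_suml // => j _.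
by apply: memvZ; apply: memv_span; apply: map_f; rewrite mem_enum.
Qed.

(** The rows of [row_base A] are free and span the same space. *)
Lemma dim_span_rows (K : fieldType) (a q : nat) (A : 'M[K]_(a, q)) :
  \dim <<[seq row i A | i <- enum 'I_a]>>%VS = \rank A.
Proof.
pose B := row_base A; pose X := [tuple row i B | i < \rank A].
have -> : <<[seq row i A | i <- enum 'I_a]>>%VS = <<X>>%VS.
  apply/eqP; rewrite eqEsubv /X /= !span_rowsS //.
    by rewrite eq_row_base.
  by rewrite eq_row_base.
suff /eqP -> : free X by rewrite size_tuple.
apply/freeP => c sumc i.
have : (\row_j c j) *m B = 0 *m B.
  rewrite mul0mx -[RHS]sumc mulmx_sum_row; apply: eq_bigr => j _.
  by rewrite mxE -tnth_nth tnth_mktuple.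
by move=> /(row_free_inj (row_base_free A)) /rowP /(_ i); rewrite !mxE.
Qed.

(** * The conditions imposed at given points *)

Section ConditionMatrix.
Context (K : fieldType) (n d : nat).
Implicit Type D : {set 'X_{1..n.+1 < d.+1}}.

Definition cond_entry r (m : 'I_r -> nat) (p : 'M[K]_(r, n.+1)) (u : rowidx n m)
    (a : 'X_{1..n.+1}) : K :=
  (mderivm (tagged u) 'X_[a]).@[p (tag u)].

Definition condmx D r (m : 'I_r -> nat) (p : 'M[K]_(r, n.+1)) :
    'M[K]_(#|{: rowidx n m}|, #|D|) :=
  \matrix_(x, y) cond_entry p (enum_val x) (bmnm (enum_val y)).

Lemma indhomogXE (a : 'X_{1..n.+1}) : mdeg a = d ->
  mpoly_of_dhomog (indhomog d 'X_[K, a]) = 'X_[a].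
Proof. by move=> dega; rewrite [LHS]insubdK // -dega dhomogX. Qed.

Lemma free_VD D : D \subset Ddeg n d ->
  free [tuple indhomog d 'X_[K, bmnm (enum_val y)] | y < #|D|].
Proof.
move=> sD; apply/freeP => c; under eq_bigr do rewrite -tnth_nth tnth_mktuple.
move=> sumc y.
have degD (z : 'I_#|D|) : mdeg (bmnm (enum_val z)) = d.
  by apply/eqP; have := subsetP sD _ (enum_valP z); rewrite inE.
have /(congr1 (mcoeff (bmnm (enum_val y)))) := congr1 (@mpoly_of_dhomog _ _ _) sumc.
rewrite !raddf_sum /= mcoeff0 (bigD1 y) //= big1 ?addr0 => [|z neq].
  by rewrite linearZ /= indhomogXE // mcoeffX eqxx mulr1.
rewrite linearZ /= indhomogXE // mcoeffX.
case: eqP => [/val_inj/enum_val_inj eqzy|]; last by rewrite mulr0.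
by rewrite eqzy eqxx in neq.
Qed.

(** [V_D(m p)] is the kernel, in the span of the monomials, of the map that
    evaluates all the conditions, and the image of that map is spanned by the
    columns of [condmx]. *)
Lemma dim_VDp D (sD : D \subset Ddeg n d) r (m : 'I_r -> nat)
    (p : 'M[K]_(r, n.+1)) :
  \dim (VDp D m p) = (#|D| - \rank (condmx D m p))%N.
Proof.
pose X := [tuple indhomog d 'X_[K, bmnm (enum_val y)] | y < #|D|].
have VDE : VD K D = <<X>>%VS.
  apply: eq_span => f; apply/mapP/mapP => [[a aD ->]|[y _ ->]].
    rewrite mem_enum in aD.
    by exists (enum_rank_in aD a); rewrite ?mem_enum // enum_rankK_in.
  by exists (enum_val y); rewrite // mem_enum enum_valP.
pose Phi (f : dhomog n.+1 K d) : 'rV[K]_#|{: rowidx n m}| :=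
  \row_x (let u : rowidx n m := enum_val x in
    deriv_at (tagged u) (p (tag u)) f).
have linPhi : linear Phi
  by move=> c f g; apply/rowP => x; rewrite !mxE; exact: deriv_at_is_linear.
pose PhiL : {linear _ -> _} :=
  HB.pack Phi (GRing.isLinear.Build _ _ _ _ Phi linPhi).
have VDpE : VDp D m p = (<<X>> :&: lker (linfun PhiL))%VS.
  rewrite /VDp VDE; congr (_ :&: _)%VS; apply/vspaceP => f.
  rewrite memv_ker lfunE /=.
  apply/idP/eqP => [/subv_bigcapP fV | Phif0].
    apply/rowP => x; rewrite !mxE /=.
    have /mem_Vmult := fV (tag (enum_val x)) isT; apply.
    exact: bmdeg.
  apply/subv_bigcapP => i _; apply/mem_Vmult => b ltb.
  pose u : rowidx n m := Tagged (fun i => 'X_{1..n.+1 < m i}) (BMultinom ltb).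
  have := congr1 (fun v : 'rV_ _ => v 0 (enum_rank u)) Phif0.
  by rewrite !mxE enum_rankK.
have imE : (linfun PhiL @: <<X>>)%VS
    = <<[seq row y (condmx D m p)^T | y <- enum 'I_#|D|]>>%VS.
  rewrite limg_span /= -map_comp; congr (span _); apply: eq_map => y.
  rewrite [LHS](lfunE PhiL); apply/rowP => x; rewrite !mxE /deriv_at indhomogXE //.
  by apply/eqP; have := subsetP sD _ (enum_valP y); rewrite inE.
have := limg_ker_dim (linfun PhiL) <<X>>%VS.
rewrite -VDpE imE dim_span_rows mxrank_tr (eqP (free_VD sD)) size_tuple.
by move/(congr1 (subn^~ (\rank (condmx D m p)))); rewrite addnK.
Qed.
End ConditionMatrix.

(** * Multihomogeneity of the minors *)

Section BlockMonomials.
Context (n r : nat).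

(** The exponent of P_i^a, as a monomial in all the coordinates. *)
Definition block_mnm (i : 'I_r) (a : 'X_{1..n.+1}) : 'X_{1..r * n.+1} :=
  (\sum_(j < n.+1) U_(mxvec_index i j) *+ a j)%MM.

Lemma block_mnmE i a i' j' :
  block_mnm i a (mxvec_index i' j') = if i == i' then a j' else 0%N.
Proof.
have idx_inj j : (mxvec_index i j == mxvec_index i' j') = (i == i') && (j == j').
  rewrite /mxvec_index (inj_eq (@cast_ord_inj _ _ _)) (inj_eq enum_rank_inj).
  by rewrite xpair_eqE.
rewrite mnm_sumE (bigD1 j') //= big1 => [|j neq]; last first.
  by rewrite mulmnE mnm1E idx_inj (negPf neq) andbF.
by rewrite mulmnE mnm1E idx_inj eqxx andbT addn0; case: eqP; rewrite ?mul1n.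
Qed.

Lemma block_mnmD i a b : block_mnm i (a + b)%MM = (block_mnm i a + block_mnm i b)%MM.
Proof.
apply/mnmP => k; case/mxvec_indexP: k => i' j.
by rewrite mnmDE !block_mnmE; case: eqP; rewrite ?mnmDE.
Qed.

(** The coefficient in the b-th derivative of X^a. *)
Definition fall_mnm (a b : 'X_{1..n.+1}) : nat := \prod_(j < n.+1) (a j) ^_ (b j).

Lemma fall_mnm_eq0 a b : ~~ (b <= a)%MM -> fall_mnm a b = 0%N.
Proof.
move=> /mnm_lepP nle; apply/eqP; apply: contra_notT nle => nz j.
rewrite leqNgt; apply: contra nz => /ffact_small eq0.
by rewrite /fall_mnm (bigD1 j) //= eq0.
Qed.

Context (K : fieldType) (m : 'I_r -> nat).
Implicit Types (u : rowidx n m) (a b : 'X_{1..n.+1}).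

Lemma MentryE u a :
  Mentry K u a = (fall_mnm a (tagged u))%:R
                   *: 'X_[block_mnm (tag u) (a - tagged u)].
Proof.
rewrite /Mentry mderivmX comp_mpolyZ comp_mpolyX; congr (_ *: _).
rewrite -mprodXnE; apply: eq_bigr => j _.
by rewrite tnth_mktuple.
Qed.

(** Multiplying by P_i^b removes the dependence of the exponent on b and the
    truncated difference a - b, even when the derivative vanishes. *)
Lemma Mentry_shift u a :
  'X_[block_mnm (tag u) (tagged u)] * Mentry K u a
    = (fall_mnm a (tagged u))%:R *: 'X_[block_mnm (tag u) a].
Proof.
rewrite MentryE -scalerAr -mpolyXD.
case: (boolP (tagged u <= a)%MM) => [le|/fall_mnm_eq0 ->]; last by rewrite !scale0r.
by rewrite -block_mnmD addmC submK.
Qed.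

Lemma meval_Mentry (p : 'M[K]_(r, n.+1)) u a :
  (Mentry K u a).@[mxvec p 0] = cond_entry p u a.
Proof.
rewrite /Mentry comp_mpoly_meval; apply: meval_eq => j.
by rewrite tnth_mktuple mevalXU mxvecE.
Qed.

Definition block_homog (e : 'I_r -> nat) (g : {mpoly K[r * n.+1]}) : Prop :=
  forall c, c \in msupp g ->
    forall i, (\sum_(j < n.+1) c (mxvec_index i j))%N = e i.

Lemma block_homogM e1 e2 g1 g2 : block_homog e1 g1 -> block_homog e2 g2 ->
  block_homog (fun i => e1 i + e2 i)%N (g1 * g2).
Proof.
move=> h1 h2 c /msuppM_le /allpairsP[[c1 c2] /= [c1g c2g ->]] i.
rewrite -(h1 _ c1g) -(h2 _ c2g) -big_split.
by apply: eq_bigr => j _; rewrite mnmDE.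
Qed.

Lemma block_homog_prod (I : Type) (s : seq I) (e : I -> 'I_r -> nat) g :
    (forall x, block_homog (e x) (g x)) ->
  block_homog (fun i => \sum_(x <- s) e x i)%N (\prod_(x <- s) g x).
Proof.
move=> h; elim: s => [|x s IH].
  rewrite big_nil => c; rewrite msupp1 inE => /eqP -> i.
  by rewrite big_nil big1 // => j _; rewrite mnm0E.
rewrite big_cons => c /(block_homogM (h x) IH) hc i.
by rewrite hc big_cons.
Qed.

Lemma block_homog_sum (I : Type) (s : seq I) e (g : I -> {mpoly K[r * n.+1]}) :
    (forall x, block_homog e (g x)) -> block_homog e (\sum_(x <- s) g x).
Proof.
move=> h; elim: s => [|x s IH]; first by rewrite big_nil => c; rewrite msupp0.
rewrite big_cons => c /msuppD_le; rewrite mem_cat => /orP[/h //|/IH //].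
Qed.

(** The zero polynomial is homogeneous of any degree, so the truncation of
    [d - mdeg b] is harmless. *)
Lemma block_homog_Mentry d u a : mdeg a = d ->
  block_homog (fun i => if tag u == i then d - mdeg (tagged u) else 0)%N
    (Mentry K u a).
Proof.
move=> dega c; rewrite MentryE.
case: (boolP (tagged u <= a)%MM) => [le|/fall_mnm_eq0 ->]; last first.
  by rewrite scale0r msupp0.
move=> /msuppZ_le; rewrite msuppX inE => /eqP -> i.
under eq_bigr do rewrite block_mnmE.
case: eqP => _; last by rewrite big1.
by rewrite -dega -[in RHS](submK le) mdegD addnK mdegE.
Qed.
End BlockMonomials.

Section SymbolicMinors.
Context (K : fieldType) (n d r : nat) (m : 'I_r -> nat) (N : nat).
Implicit Types (f : 'I_N -> rowidx n m) (g : 'I_N -> 'X_{1..n.+1 < d.+1}).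

Definition symb_minor f g : {mpoly K[r * n.+1]} :=
  \det (\matrix_(x, y) Mentry K (f x) (bmnm (g y))).

(** The degrees of the entries depend only on their rows, so all the terms of
    the determinant have the same multidegree. *)
Lemma multihomogeneous_symb_minor f g : (forall y, g y \in Ddeg n d) ->
  multihomogeneous (symb_minor f g).
Proof.
move=> gd; eexists; apply: block_homog_sum => s.
rewrite mulr_sign => c cs.
have {}cs : c \in msupp
    (\prod_x (\matrix_(x, y) Mentry K (f x) (bmnm (g y))) x (s x)).
  by case: odd_perm cs; rewrite // (perm_mem (msuppN _)).
apply: block_homog_prod cs => x; rewrite mxE; apply: (@block_homog_Mentry _ _ _ _ d).
by apply/eqP; have := gd (s x); rewrite inE.
Qed.

Lemma meval_symb_minor f g (p : 'M[K]_(r, n.+1)) :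
  (symb_minor f g).@[mxvec p 0]
    = \det (\matrix_(x, y) cond_entry p (f x) (bmnm (g y))).
Proof.
rewrite -det_map_mx; congr (\det _); apply/matrixP => x y.
by rewrite !mxE [LHS]meval_Mentry.
Qed.
End SymbolicMinors.

(** * The dimension at general points *)

Lemma max_measure (T : Type) (P : T -> Prop) (f : T -> nat) (B : nat) :
    (forall x, f x <= B)%N -> (exists x, P x) ->
  exists2 x, P x & forall y, P y -> (f y <= f x)%N.
Proof.
move=> leB [x]; have [k] := ubnP (B - f x)%N.
elim: k x => // k IH x ltk Px.
have [[y Py lt_xy]|nex] := Classical_Prop.classic (exists2 y, P y & (f x < f y)%N).
  apply: IH Py; rewrite ltnS in ltk.
  by apply: leq_trans ltk; rewrite ltn_sub2l // (leq_trans lt_xy).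
exists x => // y Py; rewrite leqNgt; apply/negP => lt_xy.
by apply: nex; exists y.
Qed.

Section GeneralDim.
Context (K : fieldType) (n d : nat) (D : {set 'X_{1..n.+1 < d.+1}}).
Hypothesis sD : D \subset Ddeg n d.

Context (r : nat) (m : 'I_r -> nat).

Lemma condmx_minor (p : 'M[K]_(r, n.+1)) :
  exists (f : 'I_(\rank (condmx D m p)) -> rowidx n m)
         (g : 'I_(\rank (condmx D m p)) -> 'X_{1..n.+1 < d.+1}),
    [/\ injective g, forall y, g y \in D
      & \det (\matrix_(x, y) cond_entry p (f x) (bmnm (g y))) != 0].
Proof.
have [f [g [inj_g ufg]]] := unit_mxsub_exists (condmx D m p).
exists (enum_val \o f), (enum_val \o g); split=> [||].
- by move=> y z /enum_val_inj/inj_g.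
- by move=> y; apply: enum_valP.
rewrite unitmxE unitfE in ufg.
by congr (\det _ != 0): ufg; apply/matrixP => x y; rewrite !mxE.
Qed.

Lemma leq_rank_condmx N (p : 'M[K]_(r, n.+1)) (f : 'I_N -> rowidx n m)
    (g : 'I_N -> 'X_{1..n.+1 < d.+1}) : (forall y, g y \in D) ->
  \det (\matrix_(x, y) cond_entry p (f x) (bmnm (g y))) != 0 ->
  (N <= \rank (condmx D m p))%N.
Proof.
move=> gD nz.
apply: (@leq_rank_unit_mxsub _ _ _ _ _ (enum_rank \o f)
         (fun y => enum_rank_in (gD y) (g y))).
rewrite unitmxE unitfE; congr (\det _ != 0): nz; apply/matrixP => x y.
by rewrite !mxE enum_rankK enum_rankK_in.
Qed.

(** The rank is at most its maximal value, and it reaches that value wherever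
    a given minor of that size does not vanish. *)
Lemma general_dimP : is_general_dim K D m (general_dim K D m).
Proof.
apply: ClassicalEpsilon.epsilon_spec.
have [|p0 pt0 max0] := @max_measure 'M[K]_(r, n.+1) (@is_point K n r)
  (fun p => \rank (condmx D m p)) _ (fun p => rank_leq_row _).
  exists (const_mx 1) => i; apply/eqP => /rowP/(_ 0).
  by rewrite !mxE => /eqP; rewrite oner_eq0.
have [f [g [_ gD nz]]] := condmx_minor p0.
exists (#|D| - \rank (condmx D m p0))%N.
exists (fun p => (symb_minor K f g).@[mxvec p 0] != 0); split.
- exists (fun h => h = symb_minor K f g); split=> [_ ->|p _].
    apply: multihomogeneous_symb_minor => y.
    exact: (subsetP sD).
  by split=> [?|[_ -> //]]; exists (symb_minor K f g).
- by exists p0; rewrite // meval_symb_minor.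
move=> p pt; rewrite meval_symb_minor => nzp; rewrite dim_VDp //.
by congr (_ - _)%N; apply/eqP; rewrite eqn_leq max0 //= (leq_rank_condmx gD nzp).
Qed.

Lemma mpoly_nonroot_point (g : {mpoly K[r * n.+1]}) :
    [pchar K] =i pred0 -> g != 0 ->
  exists2 p : 'M[K]_(r, n.+1), is_point p & g.@[mxvec p 0] != 0.
Proof.
move=> charK /(mpoly_nonroot charK)[x nx gx].
have vK k : mxvec (vec_mx (\row_k x k) : 'M_(r, n.+1)) 0 k = x k.
  by rewrite vec_mxK mxE.
exists (vec_mx (\row_k x k)); last by rewrite (meval_eq _ vK).
move=> i; apply/eqP => /rowP/(_ 0)/eqP.
by rewrite mxE -mxvecE vK mxE (negPf (nx _)).
Qed.

(** Two nonempty open sets meet: if [g] defines an open set on which the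
    dimension is the general one, and [h] is a minor of size the rank at [p]
    which does not vanish at [p], then at a point where [g * h] does not vanish
    the rank is at least the rank at [p]. *)
Lemma general_dim_le (charK : [pchar K] =i pred0) (p : 'M[K]_(r, n.+1)) :
  (general_dim K D m <= \dim (VDp D m p))%N.
Proof.
have [W [[S [_ WE]] [p1 pt1 W1] dimW]] := general_dimP.
have [g Sg nzg] := (WE _ pt1).1 W1.
have [f [h [_ hD nz]]] := condmx_minor p.
have nzgh : g * symb_minor K f h != 0.
  apply: mulf_neq0; first by apply: contraNneq nzg => ->; rewrite meval0.
  by apply: contraNneq nz => eq0; rewrite -meval_symb_minor eq0 meval0.
have [q ptq] := mpoly_nonroot_point charK nzgh.
rewrite mevalM mulf_eq0 negb_or => /andP[gq hq].
rewrite -(dimW q ptq) ?WE //; last by exists g.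
rewrite !dim_VDp // leq_sub2l // (leq_rank_condmx hD (f := f)) //.
by rewrite -meval_symb_minor.
Qed.
End GeneralDim.

(** * Determinants expanded by classes of columns *)

(** The form in which invertibility is used below: unlike determinants,
    kernels are insensitive to signs and to the enumeration of the rows and
    the columns. *)
Lemma det_neq0P (K : fieldType) N (A : 'M[K]_N) :
  \det A != 0 <->
  forall v : 'I_N -> K, (forall x, \sum_y A x y * v y = 0) -> forall y, v y = 0.
Proof.
split=> [nz v Av0 y|inj].
  have uA : A \in unitmx by rewrite unitmxE unitfE.
  have : A *m (\col_z v z) = 0.
    apply/matrixP => x z; rewrite !mxE -[RHS](Av0 x).
    by apply: eq_bigr => z' _; rewrite mxE.
  move/(congr1 (mulmx (invmx A))); rewrite mulKmx // mulmx0.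
  by move/matrixP/(_ y 0); rewrite !mxE.
rewrite -det_tr; apply/det0P => -[v nzv vA]; case/eqP: nzv.
apply/rowP => y; rewrite mxE; apply: (inj (fun y => v 0 y)) => x.
have /rowP/(_ x) := vA; rewrite !mxE => sum0; rewrite -[RHS]sum0.
by apply: eq_bigr => z _; rewrite mxE mulrC.
Qed.

Section MaskedDeterminant.
Context (K : fieldType) (N : nat) (T : finType) (t : 'I_N -> T) (c : 'M[K]_N).

(** Its determinant collects the terms of [\det c] whose bijection from rows to
    columns respects the classes [t] and [phi]. *)
Definition maskmx (phi : 'I_N -> T) : 'M[K]_N :=
  \matrix_(x, y) (if t x == phi y then c x y else 0).

(** A bijection s from rows to columns contributes to exactly one [phi],
    namely t o s^-1. *)
Lemma det_monomial_rows M (w : T -> 'I_N -> 'X_{1..M}) :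
  \det (\matrix_(x, y) (c x y *: 'X_[K, w (t x) y]))
    = \sum_(phi : {ffun 'I_N -> T})
        \det (maskmx phi) *: 'X_[(\sum_y w (phi y) y)%MM].
Proof.
rewrite /determinant; under [RHS]eq_bigr do rewrite scaler_suml.
rewrite exchange_big; apply: eq_bigr => s _ /=.
pose phi_s := [ffun y => t ((s^-1)%g y)].
rewrite (bigD1 phi_s) //= [X in _ + X]big1 ?addr0 => [|phi neq]; last first.
  have [x neqx] : exists x, t x != phi (s x).
    apply/existsP; rewrite -negb_forall; apply: contra neq => /forallP eqphi.
    apply/eqP/ffunP => y; rewrite ffunE.
    by have /eqP -> := eqphi ((s^-1)%g y); rewrite permKV.
  by rewrite (bigD1 x) //= mxE (negPf neqx) mul0r mulr0 scale0r.
under eq_bigr do rewrite mxE.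
rewrite scaler_prod -scalerAr mprodXE.
have -> : (-1) ^+ s = ((-1) ^+ s : K)%:MP :> {mpoly K[M]}.
  by rewrite rmorphXn rmorphN1.
rewrite mul_mpolyC scalerA mulrC; congr (_ *: 'X_[_]).
  congr (_ * _); apply: eq_bigr => x _; by rewrite mxE ffunE permK eqxx.
rewrite [RHS](reindex_inj (@perm_inj _ s)).
by apply: eq_bigr => x _; rewrite ffunE permK.
Qed.

Lemma mask_perm phi : \det (maskmx phi) != 0 ->
  exists s : 'S_N, forall x, t x = phi (s x).
Proof.
case: (boolP [exists s : 'S_N, [forall x, t x == phi (s x)]]) => [|/existsPn none].
  by case/existsP=> s /forallP ts _; exists s => x; apply/eqP.
case/eqP; rewrite /determinant big1 // => s _.
have := none s; rewrite negb_forall => /existsP[x neq].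
by rewrite (bigD1 x) //= mxE (negPf neq) mul0r mulr0.
Qed.

(** Up to the order of the rows and the columns, [maskmx phi] is block
    diagonal, with one block for each class. *)
Lemma det_mask_neq0 phi : \det (maskmx phi) != 0 <->
  forall (i : T) (v : 'I_N -> K),
    (forall x, t x = i -> \sum_(y | phi y == i) c x y * v y = 0) ->
    forall y, phi y = i -> v y = 0.
Proof.
have mask_sum x v : \sum_y maskmx phi x y * v y
                    = \sum_(y | phi y == t x) c x y * v y.
  rewrite [RHS]big_mkcond; apply: eq_bigr => y _.
  by rewrite mxE eq_sym; case: eqP; rewrite ?mul0r.
rewrite det_neq0P; split=> [inj i v v0 y phiy|inj v v0 y].
  (* Extended by 0, a kernel vector of one block is one of the whole matrix. *)
  pose v' z := if phi z == i then v z else 0.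
  rewrite -[LHS]/(v y); have <- : v' y = v y by rewrite /v' phiy eqxx.
  apply: inj => x; rewrite mask_sum; have [tx|ntx] := eqVneq (t x) i.
    rewrite tx -[RHS](v0 x tx); apply: eq_bigr => z phiz.
    by rewrite /v' phiz.
  rewrite big1 // => z /eqP phiz.
  by rewrite /v' phiz (negPf ntx) mulr0.
apply: (inj (phi y)) => // x tx.
by rewrite -[RHS](v0 x) mask_sum tx.
Qed.
End MaskedDeterminant.

(** * The minors det(U'_i, E_i) *)

Lemma conform_square (R : nmodType) p q (e : p = q) (A : 'M[R]_(p, q)) :
  conform_mx (0 : 'M[R]_p) A = \matrix_(x, y) A x (cast_ord e y).
Proof.
case: q / e A => A; rewrite conform_mx_id; apply/matrixP => x y.
by rewrite mxE cast_ord_id.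
Qed.

Section Minors.
Context (K : fieldType) (n d r : nat) (m : 'I_r -> nat).

Lemma mpolyX_neq0 k (a : 'X_{1..k}) : 'X_[K, a] != 0.
Proof. by rewrite -msupp_eq0 msuppX. Qed.

(** All the rows belong to the same point P_i, so that the minor is the
    determinant of its numerical coefficients times a monomial in P_i: rescaling
    the rows by P_i^b leaves the numerical matrix with its columns scaled by
    P_i^a. *)
Lemma minor_neq0P (I : {set rowidx n m}) (J : {set 'X_{1..n.+1 < d.+1}}) i :
    (forall u, u \in I -> tag u = i) -> #|I| = #|J| ->
  minor K I J != 0 <->
  forall v : 'X_{1..n.+1 < d.+1} -> K,
    (forall u, u \in I ->
       \sum_(a in J) (fall_mnm (bmnm a) (tagged u))%:R * v a = 0) ->
    forall a, a \in J -> v a = 0.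
Proof.
move=> tagI e; rewrite /minor (conform_square e).
set A := \matrix_(x, y) _.
pose a_ (y : 'I_#|I|) := enum_val (cast_ord e y).
pose B : 'M[K]_#|I| := \matrix_(x, y)
  (let u : rowidx n m := enum_val x in fall_mnm (bmnm (a_ y)) (tagged u))%:R.
pose rb : 'rV[{mpoly K[r * n.+1]}]_#|I| := \row_x
  (let u : rowidx n m := enum_val x in 'X_[block_mnm i (tagged u)]).
pose ra : 'rV[{mpoly K[r * n.+1]}]_#|I| := \row_y 'X_[block_mnm i (bmnm (a_ y))].
have detAB : \prod_x rb 0 x * \det A = (\det B)%:MP * \prod_y ra 0 y.
  rewrite -[(\det B)%:MP]det_map_mx -!det_diag -!det_mulmx; congr (\det _).
  rewrite mul_diag_mx mul_mx_diag; apply/matrixP => x y; rewrite !mxE mul_mpolyC.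
  by rewrite -(tagI _ (enum_valP x)) [LHS]Mentry_shift.
have nzX k (rX : 'I_k -> {mpoly K[r * n.+1]}) :
  (forall x, rX x != 0) -> \prod_x rX x != 0 by move=> nz; apply/prodf_neq0.
have -> : \det A != 0 <-> \det B != 0.
  have : (\prod_x rb 0 x * \det A != 0) = (\det B != 0).
    rewrite detAB mulf_eq0 mpolyC_eq0 negb_or nzX ?andbT // => y.
    by rewrite mxE mpolyX_neq0.
  rewrite mulf_eq0 negb_or nzX /= => [-> //|x].
  by rewrite mxE mpolyX_neq0.
have sumJ (F : 'X_{1..n.+1 < d.+1} -> K) : \sum_(a in J) F a = \sum_y F (a_ y).
  rewrite big_enum_val (reindex (cast_ord e)) //; apply: onW_bij.
  by exists (cast_ord (esym e)); [apply: cast_ordK | apply: cast_ordKV].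
rewrite det_neq0P; split=> [inj v v0 a aJ|inj v v0 y].
  have -> : a = a_ (cast_ord (esym e) (enum_rank_in aJ a)).
    by rewrite /a_ cast_ordKV enum_rankK_in.
  apply: (inj (v \o a_)) => x; rewrite -[RHS](v0 _ (enum_valP x)) sumJ.
  by apply: eq_bigr => z _; rewrite mxE.
(* The sum has a single term: this inverts the enumeration of J. *)
pose v' a := \sum_(z | a_ z == a) v z.
have a_inj : injective a_ by move=> z z' /enum_val_inj/cast_ord_inj.
have v'E z : v' (a_ z) = v z.
  by rewrite /v' (big_pred1 z) // => z'; rewrite (inj_eq a_inj).
rewrite -v'E; apply: inj => [u uI|]; last exact: enum_valP.
rewrite sumJ -[RHS](v0 (enum_rank_in uI u)); apply: eq_bigr => z _.
by rewrite v'E mxE enum_rankK_in.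
Qed.
End Minors.

(** * The exceptional monomial in the mixed determinant *)

(** The square matrix of the main argument.  Its rows are those of U', marked
    by [Some], and further rows of constants, marked by [None].  Its columns
    are those of D' and others in D, and on the latter the constant rows
    have a trivial kernel. *)
Section MixedDeterminant.
Context (K : fieldType) (n d r : nat) (m : 'I_r -> nat).
Context (D D' : {set 'X_{1..n.+1 < d.+1}}) (U' : {set rowidx n m}).
Context (E : {ffun 'I_r -> {set 'X_{1..n.+1 < d.+1}}}).
Hypothesis excE : exceptional K D U' D' E.
Context (N : nat) (R : 'I_N -> option (rowidx n m)).
Context (col : 'I_N -> 'X_{1..n.+1 < d.+1}) (C0 : 'M[K]_N).
Hypothesis R_U' : forall u, u \in U' <-> exists x, R x = Some u.
Hypothesis R_inj : forall u x y, R x = Some u -> R y = Some u -> x = y.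
Hypothesis col_inj : injective col.
Hypothesis col_D : forall y, col y \in D.
Hypothesis col_D' : forall a, a \in D' -> exists y, col y = a.
Hypothesis C0_inj : forall v : 'I_N -> K,
  (forall x, R x = None -> \sum_(y | col y \notin D') C0 x y * v y = 0) ->
  forall y, col y \notin D' -> v y = 0.

Definition mixed_mx : 'M[{mpoly K[r * n.+1]}]_N :=
  \matrix_(x, y) (if R x is Some u then Mentry K u (bmnm (col y))
                  else (C0 x y)%:MP).

Definition row_class x : option 'I_r :=
  if R x is Some u then Some (tag u) else None.

Definition coef_mx : 'M[K]_N :=
  \matrix_(x, y) (if R x is Some u
                  then (fall_mnm (bmnm (col y)) (tagged u))%:R else C0 x y).

Definition class_mnm (i : option 'I_r) y : 'X_{1..r * n.+1} :=
  if i is Some i then block_mnm i (bmnm (col y)) else 0%MM.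

(** The exponent of prod_i P_i^(a_i), for the partition given by [phi]. *)
Definition weight (phi : 'I_N -> option 'I_r) : 'X_{1..r * n.+1} :=
  (\sum_y class_mnm (phi y) y)%MM.

Definition class_part (phi : 'I_N -> option 'I_r) :
    {ffun 'I_r -> {set 'X_{1..n.+1 < d.+1}}} :=
  [ffun i => col @: [set y | phi y == Some i]].

(** Sends the columns outside of D' to the class of the constant rows. *)
Definition E_class : 'I_N -> option 'I_r := fun y => [pick i | col y \in E i].

Lemma mem_class_part phi i y : (col y \in class_part phi i) = (phi y == Some i).
Proof. by rewrite ffunE mem_imset // inE. Qed.

Lemma E_classP y i : (E_class y == Some i) = (col y \in E i).
Proof.
have [[_ disjE _] _ _] := excE.
rewrite /E_class; case: pickP => [j yEj|/(_ i) -> //].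
apply/eqP/idP => [[<-] //|yEi]; congr Some; apply/eqP.
apply: contraT => /disjE /pred0P/(_ (col y)).
by rewrite /= yEj yEi.
Qed.

Lemma E_class_None y : (E_class y == None) = (col y \notin D').
Proof.
have [[defD' _ _] _ _] := excE.
rewrite -defD'; case def: (E_class y) => [i|].
  apply/esym/negbTE; rewrite negbK; apply/bigcupP; exists i => //.
  by rewrite -E_classP def.
apply/esym/bigcupP => -[i _]; by rewrite -E_classP def.
Qed.

Lemma class_part_E : class_part E_class = E.
Proof.
have [[defD' _ _] _ _] := excE.
apply/ffunP => i; apply/setP => a; apply/idP/idP => [|aE].
  by rewrite ffunE => /imsetP[y]; rewrite inE E_classP => yE ->.
have /col_D' [y def_a] : a \in D' by rewrite -defD'; apply/bigcupP; exists i.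
by rewrite -def_a mem_class_part E_classP def_a.
Qed.

(** So two maps of the same weight give partitions with the same a_i. *)
Lemma weightE phi i j :
  weight phi (mxvec_index i j) = (expsum (class_part phi) i j).
Proof.
rewrite /expsum ffunE big_imset /=; last by move=> ? ? _ _; apply: col_inj.
rewrite !mnm_sumE [RHS]big_mkcond; apply: eq_bigr => y _.
rewrite inE; case: (phi y) => [i'|] /=; last by rewrite mnm0E.
by rewrite block_mnmE.
Qed.

Lemma card_block i : #|block U' i| = #|[set x | row_class x == Some i]|.
Proof.
rewrite -(card_in_imset (f := R)) => [|x y]; last first.
  rewrite !inE /row_class; case Rx: (R x) => [u|//] _ _ Ry.
  exact: R_inj Rx (esym Ry).
rewrite -(card_imset _ (@Some_inj _)); apply: eq_card => -[u|].
  rewrite mem_imset ?inE; last exact: Some_inj.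
  apply/andP/imsetP => [[/R_U'[x Rx] tu]|[x]].
    by exists x; rewrite // inE /row_class Rx (eqP tu).
  rewrite inE /row_class => + Rx; rewrite -Rx => /eqP[<-].
  by split=> //; apply/R_U'; exists x.
transitivity false; first by apply/negbTE/imsetP => -[].
by apply/esym/negbTE/imsetP => -[x]; rewrite inE /row_class; case: (R x).
Qed.

(** Ties the vanishing of sigma, a statement on polynomials, to the kernels of
    the blocks of the masked matrix of numbers. *)
Lemma minor_class_part_neq0 phi i : #|block U' i| = #|class_part phi i| ->
  minor K (block U' i) (class_part phi i) != 0 <->
  forall v : 'I_N -> K,
    (forall x, row_class x = Some i ->
       \sum_(y | phi y == Some i) coef_mx x y * v y = 0) ->
    forall y, phi y = Some i -> v y = 0.
Proof.
move=> eqc; rewrite (minor_neq0P K (i := i)) //; last first.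
  by move=> u; rewrite !inE => /andP[_ /eqP].
have sumP (F : 'X_{1..n.+1 < d.+1} -> K) :
    \sum_(a in class_part phi i) F a = \sum_(y | phi y == Some i) F (col y).
  rewrite ffunE big_imset /=; last by move=> ? ? _ _; apply: col_inj.
  by apply: eq_bigl => y; rewrite inE.
split=> [inj v v0 y phiy|inj v v0 a].
  (* The sum has a single term, as [col] is injective. *)
  pose v' a := \sum_(z | col z == a) v z.
  have v'E z : v' (col z) = v z.
    by rewrite /v' (big_pred1 z) // => z'; rewrite (inj_eq col_inj).
  rewrite -v'E; apply: inj => [u|]; last by rewrite mem_class_part phiy.
  rewrite !inE => /andP[/R_U'[x Rx] /eqP tu].
  rewrite sumP -[RHS](v0 x); last by rewrite /row_class Rx tu.
  by apply: eq_bigr => z _; rewrite v'E mxE Rx.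
move=> aP; have := aP; rewrite ffunE => /imsetP[y]; rewrite inE => /eqP phiy ->.
apply: (inj (v \o col)) phiy => x; rewrite /row_class.
case Rx: (R x) => [u|//] [tu].
rewrite -[RHS](v0 u) ?sumP; last first.
  by rewrite !inE tu eqxx andbT; apply/R_U'; exists x.
by apply: eq_bigr => z _; rewrite mxE Rx.
Qed.

Lemma det_mask_E_class_neq0 : \det (maskmx row_class coef_mx E_class) != 0.
Proof.
have [[_ _ cardE] sigE _] := excE.
apply/det_mask_neq0 => -[i|] v v0 y phiy.
  have eqc : #|block U' i| = #|class_part E_class i| by rewrite class_part_E cardE.
  have /(minor_class_part_neq0 eqc) : minor K (block U' i) (class_part E_class i) != 0.
    by rewrite class_part_E; move/prodf_neq0: sigE; apply.
  exact.
apply: C0_inj; last by rewrite -E_class_None phiy.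
move=> x Rx; rewrite -[RHS](v0 x) /row_class ?Rx //.
apply: eq_big => [z|z _]; first by rewrite E_class_None.
by rewrite mxE Rx.
Qed.

Lemma card_partitions U D1 F : @partitions n d r m U D1 F ->
  #|D1| = (\sum_i #|block U i|)%N.
Proof.
move=> [<- disjF cardF]; rewrite -sum1_card partition_disjoint_bigcup //.
by apply: eq_bigr => i _; rewrite sum1_card cardF.
Qed.

(** The only use of the uniqueness clause of exceptionality: a nonzero masked
    determinant makes the parts of [phi] a partition of the right sizes, with
    all its minors nonzero, and the weight gives the sums a_i. *)
Lemma mask_weight_inj phi : weight phi = weight E_class ->
  \det (maskmx row_class coef_mx phi) != 0 -> phi =1 E_class.
Proof.
move=> eqw nz; have [partE _ uniqE] := excE.
have cardP i : #|block U' i| = #|class_part phi i|.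
  (* A nonzero term of the determinant matches the columns of class i with
     the rows of class i. *)
  have [s ts] := mask_perm nz.
  rewrite card_block ffunE card_imset // -(card_imset _ (@perm_inj _ s)).
  apply: eq_card => y; rewrite inE -[y](permKV s) mem_imset; last exact: perm_inj.
  by rewrite inE ts.
have partP : partitions U' (\bigcup_i class_part phi i) (class_part phi).
  split=> // i j neq; apply/pred0P => a /=; apply/negbTE/andP => -[].
  rewrite ffunE => /imsetP[y]; rewrite inE => /eqP phiy ->.
  by rewrite mem_class_part phiy => /eqP[eqij]; rewrite eqij eqxx in neq.
have sP : sigma K U' (class_part phi) != 0.
  apply/prodf_neq0 => i _; apply/(minor_class_part_neq0 (cardP i)) => v v0.
  exact: (det_mask_neq0 _ _ _).1 nz (Some i) v v0.
have class_part_phi : class_part phi = E.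
  apply/eqP; apply: contraNT sP => /eqP neqE; apply/eqP.
  apply: (uniqE _ _ _ _ partP neqE) => [||i].
  - apply/bigcupsP => i _; apply/subsetP => a; rewrite ffunE => /imsetP[y _ ->].
    exact: col_D.
  - by rewrite (card_partitions partP) (card_partitions partE).
  by rewrite -class_part_E; apply/mnmP => j; rewrite -!weightE eqw.
move=> y; case phiy: (phi y) => [i|].
  by apply/esym/eqP; rewrite E_classP -class_part_phi mem_class_part phiy.
apply/esym; case Ey: (E_class y) => [i|//].
by have := E_classP y i; rewrite Ey eqxx -class_part_phi mem_class_part phiy.
Qed.

(** The coefficient at the weight of E comes from a single term. *)
Lemma det_mixed_mx_neq0 : \det mixed_mx != 0.
Proof.
(* Rescaling the rows by [rb] makes every entry a number times a monomial
   that depends only on the class of the row and on the column. *)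
pose rb : 'rV[{mpoly K[r * n.+1]}]_N := \row_x
  (if R x is Some u then 'X_[block_mnm (tag u) (tagged u)] else 1).
have detE : \prod_x rb 0 x * \det mixed_mx
    = \det (\matrix_(x, y) (coef_mx x y *: 'X_[K, class_mnm (row_class x) y])).
  rewrite -det_diag -det_mulmx; congr (\det _).
  rewrite mul_diag_mx; apply/matrixP => x y; rewrite !mxE /row_class.
  case: (R x) => [u|]; first exact: Mentry_shift.
  by rewrite mpolyX0 mul1r alg_mpolyC.
suff: \prod_x rb 0 x * \det mixed_mx != 0 by rewrite mulf_eq0 negb_or => /andP[].
rewrite detE det_monomial_rows.
have: (\sum_(phi : {ffun 'I_N -> option 'I_r})
    \det (maskmx row_class coef_mx phi) *: 'X_[weight phi])@_(weight E_class) != 0.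
  rewrite raddf_sum (bigD1 [ffun y => E_class y]) //= big1 ?addr0 => [|phi neq].
    rewrite mcoeffZ mcoeffX.
    have -> : weight [ffun y => E_class y] = weight E_class.
      by apply: eq_bigr => y _; rewrite ffunE.
    rewrite eqxx mulr1; have := det_mask_E_class_neq0; congr (\det _ != 0).
    by apply/matrixP => x y; rewrite !mxE ffunE.
  rewrite mcoeffZ mcoeffX; case: eqP => [eqw|]; last by rewrite mulr0.
  rewrite mulr1; apply/eqP; apply: contraNT neq => nz.
  by apply/eqP/ffunP => y; rewrite ffunE (mask_weight_inj eqw nz).
by apply: contraNneq => ->; rewrite mcoeff0.
Qed.
End MixedDeterminant.

(** * Choosing the remaining points *)

Section Reduction.
Context (K : fieldType) (n d r : nat) (m : 'I_r -> nat).
Context (k : nat) (hk : (k <= r)%N).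

Definition first_mults (i : 'I_k) : nat := m (widen_ord hk i).

Definition widen_row (u : rowidx n first_mults) : rowidx n m :=
  Tagged (fun i => 'X_{1..n.+1 < m i})
    (tagged u : 'X_{1..n.+1 < m (widen_ord hk (tag u))}).

Definition splice_points (p : 'M[K]_(k, n.+1)) (q : 'M[K]_(r, n.+1)) :
    'M[K]_(r, n.+1) :=
  \matrix_(i, j) (if insub (i : nat) is Some i' then p i' j else q i j).

Lemma cond_widen_row p q u a :
  cond_entry (splice_points p q) (widen_row u) a = cond_entry p u a.
Proof.
apply: meval_eq => j; rewrite mxE.
rewrite (insubT (fun i => (i < k)%N) (ltn_ord (tag u))).
by congr (p _ j); apply: val_inj.
Qed.

Lemma cond_splice_late p q (u : rowidx n m) a : (k <= tag u)%N ->
  cond_entry (splice_points p q) u a = cond_entry q u a.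
Proof.
move=> le_k; apply: meval_eq => j; rewrite mxE insubF //.
by apply/negbTE; rewrite -leqNgt.
Qed.

(** A nonzero minor for the first k points, of maximal size, is bordered by the
    rows U' and the columns D'. *)
Lemma rank_splice (charK : [pchar K] =i pred0)
    (D D' : {set 'X_{1..n.+1 < d.+1}}) (U' : {set rowidx n m})
    (E : {ffun 'I_r -> {set 'X_{1..n.+1 < d.+1}}}) :
    D' \subset D -> #|U'| = #|D'| -> exceptional K D U' D' E ->
    (forall u, u \in U' -> (k <= tag u)%N) ->
  forall p : 'M[K]_(k, n.+1), exists q : 'M[K]_(r, n.+1),
    (\rank (condmx (D :\: D') first_mults p) + #|D'|
       <= \rank (condmx D m (splice_points p q)))%N.
Proof.
move=> sD' eqc excE lateU' p.
have [f [g [g_inj gD nz]]] := condmx_minor (D :\: D') first_mults p.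
set rho := \rank _ in f g g_inj gD nz *.
pose R (x : 'I_(rho + #|D'|)) : option (rowidx n m) :=
  if split x is inr z then Some (enum_val (cast_ord (esym eqc) z)) else None.
pose col (y : 'I_(rho + #|D'|)) : 'X_{1..n.+1 < d.+1} :=
  match split y with inl z => g z | inr z => enum_val z end.
pose C0 : 'M[K]_(rho + #|D'|) := \matrix_(x, y)
  (if split x is inl z then cond_entry p (f z) (bmnm (col y)) else 0).
have colL z : col (lshift _ z) = g z by rewrite /col (unsplitK (inl z)).
have colR z : col (rshift _ z) = enum_val z by rewrite /col (unsplitK (inr z)).
have RL z : R (lshift _ z) = None by rewrite /R (unsplitK (inl z)).
have RR z : R (rshift _ z) = Some (enum_val (cast_ord (esym eqc) z)).
  by rewrite /R (unsplitK (inr z)).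
have gND' z : g z \notin D' by have := gD z; rewrite inE => /andP[].
have col_inj : injective col.
  move=> y y'; rewrite -[y]splitK -[y']splitK.
  case: (split y) (split y') => z [] z' /=; rewrite ?colL ?colR.
  - by move/g_inj->.
  - by move=> eqg; have := gND' z; rewrite eqg enum_valP.
  - by move=> eqg; have := gND' z'; rewrite -eqg enum_valP.
  - by move/enum_val_inj->.
have nzM : \det (mixed_mx R col C0) != 0.
  apply: (det_mixed_mx_neq0 excE) => //.
  - move=> u; split=> [uU|[x]].
      exists (rshift _ (cast_ord eqc (enum_rank_in uU u))).
      by rewrite RR cast_ordK enum_rankK_in.
    by rewrite /R; case: split => // z [<-]; apply: enum_valP.
  - move=> u x y; rewrite -[x]splitK -[y]splitK.
    case: (split x) (split y) => z [] z' /=; rewrite ?RL ?RR // => -[<-] [].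
    by move/enum_val_inj/cast_ord_inj->.
  - move=> y; rewrite -[y]splitK; case: (split y) => z /=; rewrite ?colL ?colR.
      by have := gD z; rewrite inE => /andP[].
    exact/(subsetP sD')/enum_valP.
  - move=> a aD'; exists (rshift _ (enum_rank_in aD' a)).
    by rewrite colR enum_rankK_in.
  move=> v v0 y; rewrite -[y]splitK; case: (split y) => z /=; last first.
    by rewrite colR enum_valP.
  move=> _; apply: ((det_neq0P _).1 nz (fun z => v (lshift _ z))) => x.
  rewrite -[RHS](v0 (lshift _ x)) // [RHS]big_mkcond big_split_ord /=.
  rewrite [X in _ = _ + X]big1 ?addr0 => [|z' _]; last by rewrite colR enum_valP.
  apply: eq_bigr => z' _.
  by rewrite colL gND' !mxE (unsplitK (inl x)) colL.
have [q _ nzq] := mpoly_nonroot_point charK nzM.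
exists q; pose F x := match split x with inl z => widen_row (f z)
                    | inr z => enum_val (cast_ord (esym eqc) z) end.
apply: (@leq_rank_condmx _ _ _ _ _ _ _ _ F col).
  move=> y; rewrite /col; case: split => z; last exact/(subsetP sD')/enum_valP.
  by have := gD z; rewrite inE => /andP[].
rewrite -det_map_mx in nzq; congr (\det _ != 0): nzq.
apply/matrixP => x y; rewrite !mxE /R /F; case: split => z.
  by rewrite cond_widen_row [LHS]mevalC.
rewrite cond_splice_late ?lateU' ?enum_valP //.
exact: meval_Mentry.
Qed.
End Reduction.

Local Close Scope ring_scope.

Theorem theorem2p4 (K : fieldType) (charK : [pchar K]%R =i pred0)
  (n d r : nat) (hn : 1 <= n) (hd : 1 <= d) (hr : 1 <= r)
  (D : {set 'X_{1..n.+1 < d.+1}}) (hD : D \subset Ddeg n d)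
  (m : 'I_r -> nat)
  (U' : {set rowidx n m}) (hU' : U' \subset Urows n m)
  (D' : {set 'X_{1..n.+1 < d.+1}}) (hD' : D' \subset D)
  (hsquare : #|U'| = #|D'|)
  (E : {ffun 'I_r -> {set 'X_{1..n.+1 < d.+1}}})
  (hE : exceptional K D U' D' E)
  (k : nat) (hk : k <= r)
  (hU'k : forall u, u \in U' -> k <= tag u) :
  general_dim K D m
    <= general_dim K (D :\: D') (fun i : 'I_k => m (widen_ord hk i))
  /\ (k = 0 -> general_dim K D m <= #|D :\: D'|).
Proof.
have hDD' : D :\: D' \subset Ddeg n d.
  exact: subset_trans (subsetDl _ _) hD.
have [W [_ [p ptp Wp] dimW]] := general_dimP K hDD' (first_mults m hk).
have [q rank_q] := rank_splice hk charK hD' hsquare hE hU'k p.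
have le_dim : general_dim K D m
    <= #|D :\: D'| - \rank (condmx (D :\: D') (first_mults m hk) p).
  apply: leq_trans (general_dim_le hD m charK (splice_points p q)) _.
  rewrite dim_VDp //; apply: leq_trans (leq_sub2l _ rank_q) _.
  by rewrite -(cardsID D' D) (setIidPr hD') [#|D'| + _]addnC subnDr.
split; last by move=> _; apply: leq_trans le_dim (leq_subr _ _).
by rewrite -(dimW p ptp Wp) dim_VDp.
Qed.
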